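(* Let $S^{*},\widetilde{S},X,C,G,R,\widetilde{T},T$ be random variables whose joint distribution is Markov with respect to the structural causal model with directed edges $S^{*}\to X$, $\widetilde{S}\to X$, $X\to G$, $C\to G$, $G\to R$, $G\to\widetilde{T}$, $R\to T$, where the dependence between $S^{*}$ and $\widetilde{S}$ is left arbitrary. Let $\widetilde{T}\sim p(t)$ and $T\sim q(t)$ with common value space $\mathcal{T}$. The joint law of $(S^{*},\widetilde{S},X,C,G,\widetilde{T})$ is fixed, while the conditional laws of $R$ given $G$ and of $T$ given $R$ depend on a parameter $\theta\in\Theta$, where $\Theta$ is an arbitrary set. Suppose that the model producing $\widetilde{T}$ is effective enough that $$I(\widetilde{T};\widetilde{S})=I(G;\widetilde{S}).$$ If for some $\theta_0\in\Theta$ the conditional distributions satisfy $p(t\mid\widetilde{s})=q(t\mid\widetilde{s})$ for all $t\in\mathcal{T}$ and all values $\widetilde{s}$ of $\widetilde{S}$, then $I(R;\widetilde{S})$ is maximized at $\theta_0$, i.e. its value at $\theta_0$ is the maximum of $I(R;\widetilde{S})$ over all $\theta\in\Theta$.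
   Context: All random variables take values in standard Borel spaces, and $I(\cdot\,;\cdot)$ denotes mutual information. Interpretation: $G$ is the graph data, composed of a causal part $X$ and a confounder $C$; $\widetilde{S}$ and $S^{*}$ are the factors that determine $X$; $R$ is the representation of $G$ produced by a neural network with parameters $\theta$; $\widetilde{T}$ is the prediction about $\widetilde{S}$ computed from $G$ by a fixed high-level causal model; $T$ is the prediction about $\widetilde{S}$ computed from $R$ by the network. ''Markov with respect to the structural causal model'' means that the joint law factorizes (for each $\theta$) as $$P(S^{*},\widetilde{S})\,P(C)\,P(X\mid S^{*},\widetilde{S})\,P(G\mid X,C)\,P(\widetilde{T}\mid G)\,P_\theta(R\mid G)\,P_\theta(T\mid R),$$ with $P(S^{*},\widetilde{S})$ an arbitrary joint law. $p(t)$ and $q(t)$ are the probability mass functions (or densities with respect to a common reference measure on $\mathcal{T}$) of $\widetilde{T}$ and $T$. $p(t\mid\widetilde{s})$ and $q(t\mid\widetilde{s})$ are the corresponding conditional ones given $\widetilde{S}=\widetilde{s}$; $q$ depends on $\theta$. *)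

(* Defs.v *)
From HB Require Import structures.
From mathcomp Require Import all_boot all_order all_algebra.
From mathcomp Require Import all_classical all_reals all_analysis.
From mathcomp Require Import measurable_realfun.

Set Implicit Arguments.
Unset Strict Implicit.
Unset Printing Implicit Defensive.

Import Order.TTheory GRing.Theory Num.Theory.
Import numFieldNormedType.Exports.

Local Open Scope classical_set_scope.
Local Open Scope ring_scope.
Local Open Scope ereal_scope.
Local Open Scope charge_scope.

(* A complete pseudometric that is Hausdorff is a complete metric, so U ranges
   over the nonempty Polish spaces; the empty one carries no random variable. *)
Definition standard_borel (R : realType) (d : measure_display)
    (T : measurableType d) : Prop :=
  exists (U : completePseudoMetricType R) (f : T -> U),
    [/\ hausdorff_space U, @second_countable U, bijective f &
        forall B : set T, measurable B <-> <<s @open U >> (f @` B)].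

Section pair_rv.
Context d d1 d2 (Omega : measurableType d) (T1 : measurableType d1)
  (T2 : measurableType d2).
Variables (X : {mfun Omega >-> T1}) (Y : {mfun Omega >-> T2}).

Definition pair_rv : Omega -> T1 * T2 := fun w => (X w, Y w).

Let measurable_pair_rv : measurable_fun setT pair_rv.
Proof. by apply/measurable_fun_pairP; split; exact: measurable_funPT. Qed.

HB.instance Definition _ := isMeasurableFun.Build _ _ _ _ pair_rv
  measurable_pair_rv.

End pair_rv.

(* The argument of lne is positive mu-almost everywhere. The integral is
   well-defined in \bar R because the negative part of x * ln x is bounded. *)
Definition kl_divergence (R : realType) (d : measure_display)
    (T : measurableType d) (mu nu : probability T R) : \bar R :=
  if `[< mu `<< nu >]
  then \int[mu]_x lne (('d (charge_of_finite_measure mu) '/d nu) x)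
  else +oo.

Definition mutual_info (R : realType) (d d1 d2 : measure_display)
    (Omega : measurableType d) (T1 : measurableType d1)
    (T2 : measurableType d2) (P : probability Omega R)
    (X : {mfun Omega >-> T1}) (Y : {mfun Omega >-> T2}) : \bar R :=
  kl_divergence (distribution P (pair_rv X Y))
    (distribution P X \x distribution P Y).

Section markov_scm.
Context (R : realType) (d ds0 ds dx dc dg dr dt : measure_display)
  (Omega : measurableType d) (ES0 : measurableType ds0) (ES : measurableType ds)
  (EX : measurableType dx) (EC : measurableType dc) (EG : measurableType dg)
  (ER : measurableType dr) (ET : measurableType dt).
Variables (P : probability Omega R)
  (Sstar : {mfun Omega >-> ES0}) (Stil : {mfun Omega >-> ES})
  (X : {mfun Omega >-> EX}) (C : {mfun Omega >-> EC}) (G : {mfun Omega >-> EG})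
  (Rep : {mfun Omega >-> ER}) (Ttil T : {mfun Omega >-> ET}).

(* P(S*,S~) P(C) P(X|S*,S~) P(G|X,C) P(T~|G) P(R|G) P(T|R). The factorization is
   stated on measurable rectangles, which determine the joint law. *)
Definition markov_scm : Prop :=
  exists (PS : probability (ES0 * ES)%type R) (PC : probability EC R)
    (kX : R.-pker (ES0 * ES)%type ~> EX) (kG : R.-pker (EX * EC)%type ~> EG)
    (kTtil : R.-pker EG ~> ET) (kR : R.-pker EG ~> ER) (kT : R.-pker ER ~> ET),
  forall (A0 : set ES0) (A : set ES) (B : set EX) (D : set EC) (E : set EG)
    (F : set ER) (H1 H2 : set ET),
    measurable A0 -> measurable A -> measurable B -> measurable D ->
    measurable E -> measurable F -> measurable H1 -> measurable H2 ->
    P (Sstar @^-1` A0 `&` Stil @^-1` A `&` X @^-1` B `&` C @^-1` D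
       `&` G @^-1` E `&` Rep @^-1` F `&` Ttil @^-1` H1 `&` T @^-1` H2) =
    \int[PS]_(s in A0 `*` A) \int[PC]_(c in D) \int[kX s]_(x in B)
      \int[kG (x, c)]_(g in E)
        (kTtil g H1 * \int[kR g]_(r in F) kT r H2).

End markov_scm.

Section densities.
Context (R : realType) (d ds dt : measure_display) (Omega : measurableType d)
  (ES : measurableType ds) (ET : measurableType dt).
Variables (P : probability Omega R) (nu : {measure set ET -> \bar R}).

(* Probability mass functions are the case where nu is the counting measure. *)
Definition is_density (Y : {mfun Omega >-> ET}) (p : ET -> R) : Prop :=
  [/\ measurable_fun setT p, forall t, (0 <= p t)%R &
      forall B : set ET, measurable B ->
        P (Y @^-1` B) = \int[nu]_(t in B) (p t)%:E].

(* p t s stands for p(t|s); the measures p(t|s) nu(dt) form a regular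
   conditional distribution of Y given S. *)
Definition is_cond_density (Y : {mfun Omega >-> ET}) (S : {mfun Omega >-> ES})
    (p : ET -> ES -> R) : Prop :=
  [/\ forall s, [/\ measurable_fun setT (p ^~ s), forall t, (0 <= p t s)%R &
                   \int[nu]_t (p t s)%:E = 1],
      forall B : set ET, measurable B ->
        measurable_fun setT (fun s => \int[nu]_(t in B) (p t s)%:E) &
      forall (A : set ES) (B : set ET), measurable A -> measurable B ->
        P (S @^-1` A `&` Y @^-1` B) =
        \int[distribution P S]_(s in A) \int[nu]_(t in B) (p t s)%:E].

End densities.

(* Main.v *)
(* The data processing inequality for the Kullback-Leibler divergence gives
     I(R;S~)_theta <= I(G;S~)_theta = I(T~;S~)_theta = I(T;S~)_theta0
                   <= I(R;S~)_theta0,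
   where the first inequality uses the Markov chain S~ - G - R at theta, the
   last one S~ - R - T at theta0, and the second equality holds because the
   matching conditional densities give (T~,S~) and (T,S~) the same joint law.
   For a Markov kernel K, data processing follows from ln r <= r - 1 applied to
   the ratio r = (d(mu K)/d(nu K))(y) / (d mu/d nu)(x) and integrated against
   mu(dx) K(x,dy): the integral of r is at most 1. *)
From HB Require Import structures.
Require Import Defs.
From mathcomp Require Import all_boot all_order all_algebra.
From mathcomp Require Import all_classical all_reals all_analysis.
From mathcomp Require Import measurable_realfun giry.
From mathcomp Require Import lra.

Set Implicit Arguments.
Unset Strict Implicit.
Unset Printing Implicit Defensive.

Import Order.TTheory GRing.Theory Num.Theory.

Local Open Scope classical_set_scope.
Local Open Scope ring_scope.
Local Open Scope ereal_scope.
Local Open Scope charge_scope.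

(** * The logarithmic inequality behind data processing *)

Lemma measurable_lne_EFin (R : realType) :
  measurable_fun setT (fun r : R => lne r%:E).
Proof.
apply: (@measurable_fun_ifT _ _ _ _ (cst -oo) (fun r : R => (ln r)%:E)
  (fun r => r <= 0)%R) => //.
  exact: measurable_fun_ler.
by apply/measurable_EFinP; exact: measurable_ln.
Qed.

(* ln u <= ln v + u / v - 1 with negative parts moved across, so that it can be
   integrated without integrability assumptions. *)
Lemma log_density_le (R : realType) (u v : R) : (0 <= u)%R -> (0 < v)%R ->
  maxe (lne u%:E) 0 + (maxe (- (ln v)%:E) 0 + 1) <=
  (maxe (ln v)%:E 0 + maxe (- lne u%:E) 0) + u%:E * v^-1%:E.
Proof.
rewrite le_eqVlt => /predU1P[<-|u0] v0.
  by rewrite le0_lneNy// mul0e adde0 maxye addey ?leey// -EFin_max.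
have : (1 + ln u - ln v <= u / v)%R.
  rewrite -addrA -ln_div// -lerBrDl; apply: le_trans (le_ln1Dx _); last first.
    by rewrite ltrBrDl subrr divr_gt0.
  by rewrite addrC subrK.
rewrite lne_EFin// -!EFinN -!EFin_max -EFinM -!EFinD lee_fin.
move: (ln u) (ln v) (u / v)%R => a b c abc.
by rewrite /Num.max; do 4 case: ifPn => ?; lra.
Qed.

(** * Real-valued densities and the integrals of their logarithms *)

Section density.
Context (R : realType) (d : measure_display) (T : measurableType d).
Implicit Types (mu nu : probability T R) (g : T -> R) (h : T -> \bar R).

(** The change-of-variables form is required for all nonnegative [h], so that integrals against [mu]
    become integrals against [nu] directly. *)
Definition density_of mu nu g := [/\ measurable_fun setT g,
  forall x, (0 <= g x)%R &
  forall h, (forall x, 0 <= h x) -> measurable_fun setT h ->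
    \int[mu]_x h x = \int[nu]_x (h x * (g x)%:E)].

(** The Radon-Nikodym derivative of the charge is only determined up to a null set. It is exchanged
    for the version that is nonnegative and finite everywhere; the two agree [nu]-almost everywhere,
    hence [mu]-almost everywhere by domination. *)
Lemma kl_divergence_density mu nu : mu `<< nu ->
  exists2 g, density_of mu nu g &
    kl_divergence mu nu = \int[mu]_x lne (g x)%:E.
Proof.
move=> munu; pose f := Radon_Nikodym_SigmaFinite.f mu nu.
pose rn := ('d (charge_of_finite_measure mu) '/d nu).
have ffin x : f x \is a fin_num by exact: Radon_Nikodym_SigmaFinite.f_fin_num.
have rnfin x : rn x \is a fin_num by exact: Radon_Nikodym_fin_num.
have f0 x : 0 <= f x by exact: Radon_Nikodym_SigmaFinite.f_ge0.
have mf : measurable_fun setT f.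
  exact: measurable_int (Radon_Nikodym_SigmaFinite.f_integrable _).
have mrn : measurable_fun setT rn.
  exact/(measurable_int nu)/Radon_Nikodym_integrable.
exists (fine \o f).
  split=> [|x|h h0 mh]; first exact: measurableT_comp.
    by rewrite /= fine_ge0.
  under [RHS]eq_integral do rewrite /= fineK//.
  by rewrite Radon_Nikodym_SigmaFinite.change_of_variables.
rewrite /kl_divergence; case: asboolP => // _.
under eq_integral do rewrite -/rn -[rn _]fineK//.
have mlne h : measurable_fun setT h ->
    measurable_fun setT (fun x => lne (fine (h x))%:E).
  move=> mh; apply: (measurableT_comp (@measurable_lne_EFin R)).
  exact: measurableT_comp.
apply: ae_eq_integral => //; [exact: mlne|exact: mlne|].
have := null_dominates_ae_eq measurableT munu
  (ae_eq_Radon_Nikodym_SigmaFinite munu measurableT).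
by apply: filterS => x /= /(_ I) fx _; rewrite /f fx.
Qed.

(* The density of mu vanishes only on a mu-null set, where 1 replaces it to make
   the quotient of log_density_le meaningful. *)
Definition pos_density g x : R := if (0 < g x)%R then g x else 1%R.

Lemma pos_density_gt0 g x : (0 < pos_density g x)%R.
Proof. by rewrite /pos_density; case: ifP. Qed.

Lemma measurable_pos_density g : measurable_fun setT g ->
  measurable_fun setT (pos_density g).
Proof.
move=> mg; apply: measurable_fun_ifT => //.
exact: measurable_fun_ltr.
Qed.

Variables (mu nu : probability T R) (g : T -> R).
Hypothesis mu_g : density_of mu nu g.

Lemma measurable_inv_density :
  measurable_fun setT (fun x => (pos_density g x)^-1%:E).
Proof.
have [mg _ _] := mu_g.
(* Writing the inverse as an exponential of minus a logarithm reduces measurability to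
   compositions. *)
rewrite (_ : (fun _ => _) = fun x => (expR (- ln (pos_density g x)))%:E).
  by apply/measurable_EFinP; do 3 apply: measurableT_comp => //;
    exact: measurable_pos_density.
by apply/funext => x; rewrite expRN lnK// posrE pos_density_gt0.
Qed.

Lemma density_of_integral1 : \int[nu]_x (g x)%:E = 1.
Proof.
have [mg g0 /(_ (cst 1)) mu1] := mu_g.
rewrite -[RHS](@probability_setT _ _ _ mu) -[RHS]mul1e -integral_cst// mu1//.
by apply: eq_integral => x _; rewrite mul1e.
Qed.

(** The product of [g] with the inverse of [pos_density g] is 1 where [g] is positive and 0
    elsewhere. Equality can fail because [nu] may charge the zero set of [g]. *)
Lemma density_of_integral_div h :
  (forall x, 0 <= h x) -> measurable_fun setT h ->
  \int[mu]_x (h x * (pos_density g x)^-1%:E) <= \int[nu]_x h x.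
Proof.
move=> h0 mh; have [mg g0 mu1] := mu_g.
have p0 x : 0 <= (pos_density g x)^-1%:E.
  by rewrite lee_fin invr_ge0 ltW// pos_density_gt0.
rewrite mu1; last 2 first.
- by move=> x; rewrite mule_ge0.
- apply: emeasurable_funM => //; exact: measurable_inv_density.
apply: ge0_le_integral => //.
- by move=> x _; rewrite !mule_ge0// lee_fin.
- apply: emeasurable_funM; last exact/measurable_EFinP.
  by apply: emeasurable_funM => //; exact: measurable_inv_density.
move=> x _; rewrite -muleA -EFinM -[leRHS]mule1 lee_wpmul2l// lee_fin.
rewrite /pos_density; case: ifPn => [gx|]; first by rewrite mulVf// gt_eqF.
by rewrite invr1 mul1r -leNgt => /le_trans ->.
Qed.

(** The [mu]-mass of the set where [g] vanishes is the [nu]-integral of [g] over that set. *)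
Lemma density_of_ae_gt0 : {ae mu, forall x, (0 < g x)%R}.
Proof.
have [mg g0 mu1] := mu_g.
pose N := [set x | (g x <= 0)%R].
have mN : measurable N.
  rewrite -[N]setTI; exact: measurable_fun_ler.
exists N; split => //; last by move=> x /= /negP; rewrite -leNgt.
rewrite -[N]setIT -integral_indic// mu1//; last first.
  exact/measurable_EFinP.
apply: integral0_eq => x _; rewrite indicE.
case: (boolP (x \in N)) => [|_]; last by rewrite mul0e.
rewrite inE /N /= => gx; suff -> : g x = 0%R by rewrite mule0.
by apply/le_anti; rewrite gx g0.
Qed.

Lemma density_of_lne :
  ae_eq mu setT (fun x => lne (g x)%:E) (fun x => (ln (pos_density g x))%:E).
Proof.
apply: filterS density_of_ae_gt0 => x gx _.
by rewrite lne_EFin// /pos_density gx.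
Qed.

Lemma measurable_ln_density :
  measurable_fun setT (fun x => (ln (pos_density g x))%:E).
Proof.
have [mg _ _] := mu_g.
by apply/measurable_EFinP/measurableT_comp => //; exact: measurable_pos_density.
Qed.

(* Since - ln v <= 1 / v and 1 / v integrates to at most 1 against mu. *)
Lemma density_of_ln_neg :
  \int[mu]_x (fun x => (ln (pos_density g x))%:E)^\- x <= 1.
Proof.
apply: (@le_trans _ _ (\int[mu]_x (1 * (pos_density g x)^-1%:E))).
  apply: ge0_le_integral => //.
  - exact/measurable_funeneg/measurable_ln_density.
  - apply: emeasurable_funM => //; exact: measurable_inv_density.
  move=> x _; have p0 := pos_density_gt0 g x.
  rewrite funenegE mul1e -EFinN -EFin_max lee_fin ge_max.
  by rewrite -lnV// invr_ge0 (ltW p0) andbT ltW// ln_sublinear ?invr_gt0.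
apply: (le_trans (@density_of_integral_div (cst 1) _ _)) => //.
by rewrite integral_cst// [X in _ * X]probability_setT mul1e.
Qed.

End density.

(** * Data processing for the Kullback-Leibler divergence *)

Section kl_data_processing.
Context (R : realType) d d' (X : measurableType d) (Y : measurableType d').

(** [mu'] agrees on measurable sets with the Giry bind of [mu] and [K], whose integral is the
    iterated one. *)
Lemma giry_bind_integral (mu : probability X R) (mu' : probability Y R)
    (K : X -> giry Y R) (h : Y -> \bar R) : measurable_fun setT K ->
  (forall B, measurable B -> mu' B = \int[mu]_x K x B) ->
  (forall y, 0 <= h y) -> measurable_fun setT h ->
  \int[mu']_y h y = \int[mu]_x \int[K x]_y h y.
Proof.
move=> mK mu'E h0 mh.
rewrite -[RHS](@giry_int_bind _ _ _ _ _ (mu : giry X R) K mK)//.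
apply: eq_measure_integral => B mB _.
rewrite [LHS]mu'E// /giry_bind/= giry_int_map//; exact: measurable_giry_ev.
Qed.

(** Serves to integrate [log_density_le]: the 1 on the left survives because [mu] is a probability,
    the 1 on the right bounds the integral of [C]. All terms are nonnegative, so additivity needs no
    integrability. *)
Lemma ge0_le_integral_add1 (mu : probability X R) (A B A' B' C : X -> \bar R) :
  (forall x, 0 <= A x) -> (forall x, 0 <= B x) ->
  (forall x, 0 <= A' x) -> (forall x, 0 <= B' x) -> (forall x, 0 <= C x) ->
  measurable_fun setT A -> measurable_fun setT B ->
  measurable_fun setT A' -> measurable_fun setT B' -> measurable_fun setT C ->
  (forall x, A x + (B x + 1) <= A' x + B' x + C x) -> \int[mu]_x C x <= 1 ->
  \int[mu]_x A x + (\int[mu]_x B x + 1) <=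
  \int[mu]_x A' x + \int[mu]_x B' x + 1.
Proof.
move=> A0 B0 A'0 B'0 C0 mA mB mA' mB' mC AB C1.
have -> : \int[mu]_x A x + (\int[mu]_x B x + 1) =
    \int[mu]_x (A x + (B x + 1)).
  rewrite ge0_integralD//; last 2 first.
  - by move=> x _; rewrite adde_ge0.
  - exact: emeasurable_funD.
  rewrite ge0_integralD// integral_cst//.
  by rewrite [X in 1 * X]probability_setT mule1.
apply: (@le_trans _ _ (\int[mu]_x (A' x + B' x + C x))).
  apply: ge0_le_integral => //.
  - by move=> x _; rewrite !adde_ge0.
  - by apply: emeasurable_funD => //; exact: emeasurable_funD.
  - by apply: emeasurable_funD => //; exact: emeasurable_funD.
rewrite ge0_integralD//; last 2 first.
- by move=> x _; rewrite adde_ge0.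
- exact: emeasurable_funD.
by rewrite ge0_integralD// leeD2l.
Qed.

Lemma kl_data_processing (mu nu : probability X R) (mu' nu' : probability Y R)
    (K : X -> giry Y R) : measurable_fun setT K -> (forall x, K x setT = 1) ->
  (forall B, measurable B -> mu' B = \int[mu]_x K x B) ->
  (forall B, measurable B -> nu' B = \int[nu]_x K x B) ->
  kl_divergence mu' nu' <= kl_divergence mu nu.
Proof.
move=> mK K1 mu'E nu'E.
have [munu|Nmunu] := pselect (mu `<< nu); last first.
  by rewrite {2}/kl_divergence; case: asboolP => // _; rewrite leey.
have munu' : mu' `<< nu'.
  apply/null_content_dominatesP => B mB.
  have mKB : measurable_fun setT (K ^~ B).
    exact: (measurableT_comp (measurable_giry_ev mB)).
  rewrite [X in X = _ -> _]nu'E// [X in _ -> X = _]mu'E// => nuB.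
  (* A nonnegative function with zero [nu]-integral vanishes [nu]-almost everywhere, and domination
     transfers this to [mu]. *)
  have aenu : ae_eq nu setT (K ^~ B) (cst 0).
    apply/ae_eq_integral_abs => //.
    by rewrite -[RHS]nuB; apply: eq_integral => x _; rewrite gee0_abs.
  rewrite (ge0_ae_eq_integral _ _ _ _ _ (null_dominates_ae_eq _ munu aenu))//.
  by rewrite integral0.
have [g gmu ->] := kl_divergence_density munu.
have [g' g'mu ->] := kl_divergence_density munu'.
have [mg g0 _] := gmu; have [mg' g'0 _] := g'mu.
pose a y := lne (g' y)%:E; pose b x := (ln (pos_density g x))%:E.
pose c x := (pos_density g x)^-1%:E.
have mb : measurable_fun setT b by exact: (measurable_ln_density gmu).
have ma : measurable_fun setT a.
  exact: (measurableT_comp (@measurable_lne_EFin R)).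
have c0 x : 0 <= c x by rewrite lee_fin invr_ge0 ltW// pos_density_gt0.
have mc : measurable_fun setT c by exact: (measurable_inv_density gmu).
have mEg' : measurable_fun setT (fun y => (g' y)%:E) by exact/measurable_EFinP.
have Eg'0 y : 0 <= (g' y)%:E by rewrite lee_fin.
have -> : \int[mu]_x lne (g x)%:E = \int[mu]_x b x.
  apply: ae_eq_integral => //; last exact: (density_of_lne gmu).
  exact: (measurableT_comp (@measurable_lne_EFin R)).
have a_lty : \int[mu']_y a^\- y < +oo.
  have -> : \int[mu']_y a^\- y =
      \int[mu']_y (fun y => (ln (pos_density g' y))%:E)^\- y.
    have /ae_eq_funeposneg[_ aeN] := density_of_lne g'mu.
    apply: ge0_ae_eq_integral => //; first exact: measurable_funeneg.
    exact/measurable_funeneg/(measurable_ln_density g'mu).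
  exact: le_lt_trans (density_of_ln_neg g'mu) (ltry _).
have b_lty : \int[mu]_x b^\- x < +oo.
  exact: le_lt_trans (density_of_ln_neg gmu) (ltry _).
(* Negative parts are moved to the opposite sides and 1 is added to both, which makes every term
   nonnegative. The negative parts have finite integrals, so they can be subtracted again even when
   a positive part integrates to [+oo]. *)
suff : \int[mu']_y a^\+ y + (\int[mu]_x b^\- x + 1) <=
    \int[mu]_x b^\+ x + \int[mu']_y a^\- y + 1.
  have a_ge0 : 0 <= \int[mu']_y a^\- y by exact: integral_ge0.
  have b_ge0 : 0 <= \int[mu]_x b^\- x by exact: integral_ge0.
  move=> le_ab; rewrite integralE [leRHS]integralE.
  move: le_ab a_lty a_ge0 b_lty b_ge0.
  move: (\int[mu']_y a^\- y) (\int[mu]_x b^\- x) => [a1| |]// [b1| |]//.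
  move: (\int[mu']_y a^\+ y) (\int[mu]_x b^\+ x) => [a2| |] [b2| |]//=;
    rewrite ?leey ?leNye//.
  by rewrite -!EFinD !lee_fin; lra.
rewrite [X in X + _ <= _](giry_bind_integral mK mu'E)//; last first.
  exact: measurable_funepos.
rewrite [X in _ <= _ + X + _](giry_bind_integral mK mu'E)//; last first.
  exact: measurable_funeneg.
have mint h : measurable_fun setT h -> (forall y, 0 <= h y) ->
    measurable_fun setT (fun x => \int[K x]_y h y).
  by move=> mh h0; exact: (measurableT_comp (measurable_giry_int mh h0)).
have mKa1 := mint _ (measurable_funepos ma) (@funepos_ge0 _ _ a).
have mKa2 := mint _ (measurable_funeneg ma) (@funeneg_ge0 _ _ a).
have mKg := mint _ mEg' Eg'0.
have mb1 := measurable_funepos mb.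
have mb2 := measurable_funeneg mb.
have mb21 : measurable_fun setT (fun x => b^\- x + 1).
  exact: emeasurable_funD.
have Kcst x r : \int[K x]_y cst r y = r.
  by rewrite integral_cst// [X in _ * X]K1 mule1.
(* [log_density_le] with [u = g' y] and [v = pos_density g x], integrated in [y] for fixed [x];
   terms free of [y] are preserved since [K x] has mass 1. *)
have Kle x : \int[K x]_y a^\+ y + (b^\- x + 1) <=
    (b^\+ x + \int[K x]_y a^\- y) + (\int[K x]_y (g' y)%:E) * c x.
  have : \int[K x]_y (a^\+ y + (b^\- x + 1)) <=
      \int[K x]_y ((b^\+ x + a^\- y) + (g' y)%:E * c x).
    apply: ge0_le_integral => //.
    - by move=> y _; rewrite !adde_ge0.
    - by apply: emeasurable_funD => //; exact: measurable_funepos.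
    - apply: emeasurable_funD; last exact: emeasurable_funM.
      by apply: emeasurable_funD => //; exact: measurable_funeneg.
    move=> y _; rewrite !funeposE !funenegE; apply: log_density_le => //.
    exact: pos_density_gt0.
  rewrite [leLHS]ge0_integralD//; last 2 first.
  - exact: measurable_funepos.
  - by move=> y _; rewrite adde_ge0.
  rewrite [leRHS]ge0_integralD//; last 4 first.
  - by move=> y _; rewrite adde_ge0.
  - by apply: emeasurable_funD => //; exact: measurable_funeneg.
  - by move=> y _; rewrite mule_ge0.
  - exact: emeasurable_funM.
  rewrite [X in _ <= X + _]ge0_integralD//; last exact: measurable_funeneg.
  by rewrite ge0_integralZr// !Kcst.
have Kg0 x : 0 <= \int[K x]_y (g' y)%:E by exact: integral_ge0.
have Ka10 x : 0 <= \int[K x]_y a^\+ y by exact: integral_ge0.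
have Ka20 x : 0 <= \int[K x]_y a^\- y by exact: integral_ge0.
apply: (ge0_le_integral_add1
  (C := fun x => (\int[K x]_y (g' y)%:E) * c x)) => //.
- by move=> x; rewrite mule_ge0.
- exact: emeasurable_funM.
(* The ratio integrates to at most 1: dividing by the density of [mu] leaves at most a
   [nu]-integral, which equals the [nu']-integral of [g']. *)
rewrite (le_trans (density_of_integral_div gmu Kg0 mKg))//.
by rewrite -(giry_bind_integral mK nu'E Eg'0 mEg') (density_of_integral1 g'mu).
Qed.

End kl_data_processing.

(** * Probability kernels as Giry-valued maps, and measures on products *)

Section pker_giry.
Context (R : realType) d d' (X : measurableType d) (Y : measurableType d').
Variable k : R.-pker X ~> Y.

Definition pker_eval (x : X) : set Y -> \bar R := k x.

HB.instance Definition _ x := Measure.on (pker_eval x).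

Let pker_evalT x : pker_eval x setT = 1. Proof. exact: prob_kernel. Qed.

HB.instance Definition _ x :=
  Measure_isProbability.Build _ _ _ (pker_eval x) (pker_evalT x).

Definition pker_giry (x : X) : giry Y R := pker_eval x.

Lemma measurable_pker_giry : measurable_fun setT pker_giry.
Proof.
by apply: measurable_giry_codensity => // B mB; exact: measurable_kernel.
Qed.

End pker_giry.

(** Rectangles are stable under intersection and generate the product sigma-algebra; the whole
    space, of finite mass, is the constant exhausting sequence. *)
Lemma eq_measure_rectangles (R : realType) d1 d2 (T1 : measurableType d1)
    (T2 : measurableType d2) (m1 m2 : {measure set (T1 * T2) -> \bar R}) :
  m1 setT < +oo -> (forall A B, measurable A -> measurable B ->
    m1 (A `*` B) = m2 (A `*` B)) ->
  forall C, measurable C -> m1 C = m2 C.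
Proof.
move=> m1oo m12; apply: (measure_unique
  [set A `*` B | A in measurable & B in measurable] (fun=> setT)) => //.
- by rewrite measurable_prod_measurableType.
- move=> _ _ [A mA [B mB <-]] [A' mA' [B' mB' <-]].
  exists (A `&` A'); first exact: measurableI.
  by exists (B `&` B'); [exact: measurableI|rewrite setXI].
- by move=> n; exists setT => //; exists setT => //; rewrite setXTT.
- by rewrite bigcup_const//; exists 0%N.
- by move=> _ [A mA [B mB <-]]; exact: m12.
Qed.

(** * Data processing for mutual information *)

Section mutual_info_data_processing.
Context (R : realType) d d' d1 d2 ds (Omega : measurableType d)
  (Omega' : measurableType d') (T1 : measurableType d1)
  (T2 : measurableType d2) (TS : measurableType ds).

(** The tensor product of [K] with the identity kernel: the first coordinate is resampled, the
    second is kept through a Dirac mass. *)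
Definition kernel_with (K : T1 -> giry T2 R) (z : T1 * TS) :
    giry (T2 * TS)%type R :=
  giry_prod (K z.1, giry_ret z.2).

Lemma measurable_kernel_with K : measurable_fun setT K ->
  measurable_fun setT (kernel_with K).
Proof.
move=> mK; apply: (measurableT_comp measurable_giry_prod).
apply: measurable_fun_pair; first exact: measurableT_comp.
exact: (measurableT_comp measurable_giry_ret).
Qed.

Lemma kernel_withE K z A B : measurable A -> measurable B ->
  kernel_with K z (B `*` A) = K z.1 B * (\1_A z.2)%:E.
Proof. by move=> mA mB; rewrite /kernel_with/= product_measure1E. Qed.

(** [kernel_with K] carries the joint law of [(Y, S)] to that of [(Z, S')], and the product of
    marginals to the product of marginals, so the divergence contracts. Two probability spaces are
    allowed in order to compare laws at different parameters. *)
Lemma mutual_info_data_processing (P : probability Omega R)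
    (Q : probability Omega' R) (Y : {mfun Omega >-> T1})
    (S : {mfun Omega >-> TS}) (Z : {mfun Omega' >-> T2})
    (S' : {mfun Omega' >-> TS}) (K : T1 -> giry T2 R) :
  measurable_fun setT K -> (forall y, K y setT = 1) ->
  (forall A B, measurable A -> measurable B ->
    Q (S' @^-1` A `&` Z @^-1` B) = \int[P]_(w in S @^-1` A) K (Y w) B) ->
  mutual_info Q Z S' <= mutual_info P Y S.
Proof.
move=> mK K1 QE; have mK' := measurable_kernel_with mK.
have K'1 z : kernel_with K z setT = 1.
  rewrite -setXTT kernel_withE// K1 mul1e indicE in_setT.
  by [].
have mKB B : measurable B -> measurable_fun setT (K ^~ B).
  by move=> mB; exact: (measurableT_comp (measurable_giry_ev mB)).
have mSA A : measurable A -> measurable (S @^-1` A).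
  by move=> mA; rewrite -[X in measurable X]setTI; exact: measurable_funPT.
have bindE (m : probability (T1 * TS)%type R) (C : set (T2 * TS)) :
    measurable C ->
    giry_bind m mK' C = \int[m]_z kernel_with K z C.
  move=> mC; rewrite /giry_bind/= giry_int_map//.
  exact: measurable_giry_ev.
have mKSA A B : measurable A -> measurable B ->
    measurable_fun setT (fun z : T1 * TS => K z.1 B * (\1_A z.2)%:E).
  move=> mA mB; apply: emeasurable_funM.
    exact: (measurableT_comp (mKB _ mB)).
  by apply/measurable_EFinP; exact: measurableT_comp.
apply: (kl_data_processing mK' K'1) => [C mC|C mC].
  rewrite -bindE//; apply: eq_measure_rectangles mC => [|B A mB mA].
    by rewrite [X in X < _]probability_setT ltry.
  rewrite [RHS]bindE; last exact: measurableX.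
  under eq_integral do rewrite kernel_withE//.
  rewrite [RHS]ge0_integral_distribution//; last 2 first.
  - exact: mKSA.
  - by move=> z; rewrite mule_ge0// lee_fin.
  rewrite [LHS](_ : _ = Q (S' @^-1` A `&` Z @^-1` B)); last first.
    by congr (Q _); apply/seteqP; split=> w /= [].
  rewrite QE// integral_mkcond; apply: eq_integral => w _.
  rewrite /= patchE indicE (_ : (S w \in A) = (w \in S @^-1` A)).
    by case: (_ \in _); rewrite ?mule1 ?mule0.
  by apply/idP/idP; rewrite !inE.
(* The marginals come from putting the whole space for [B], where [K] has mass 1, and then for
   [A]. *)
have PSA A : measurable A -> distribution Q S' A = distribution P S A.
  move=> mA; rewrite [LHS](_ : _ = Q (S' @^-1` A `&` Z @^-1` setT)); last first.
    by rewrite preimage_setT setIT.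
  rewrite QE//; under eq_integral do rewrite K1.
  by rewrite integral_cst ?mul1e//; exact: mSA.
have QZB B : measurable B ->
    distribution Q Z B = \int[distribution P Y]_y K y B.
  move=> mB; rewrite [LHS](_ : _ = Q (S' @^-1` setT `&` Z @^-1` B)); last first.
    by rewrite preimage_setT setTI.
  rewrite QE// preimage_setT ge0_integral_distribution//; exact: mKB.
(* The image of the product law is again a product: on rectangles, Fubini separates [K y B] from the
   mass of [A]. *)
rewrite -(bindE (distribution P Y \x distribution P S))//.
apply: product_measure_unique => // B A mB mA.
rewrite [LHS]bindE; last exact: measurableX.
under eq_integral do rewrite kernel_withE//.
rewrite fubini_tonelli1; [|exact: mKSA|by move=> z; rewrite mule_ge0// lee_fin].
rewrite [X in _ = X * _]QZB// [X in _ = _ * X]PSA//.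
rewrite -ge0_integralZr//; last exact: mKB.
apply: eq_integral => y _; rewrite /fubini_F/=.
rewrite ge0_integralZl//; last first.
  by apply/measurable_EFinP.
by rewrite integral_indic// setIT.
Qed.

End mutual_info_data_processing.

(** * Mutual information along a Markov chain *)

Section markov_chain.
Context (R : realType) d d1 d2 ds dw (Omega : measurableType d)
  (T1 : measurableType d1) (T2 : measurableType d2) (TS : measurableType ds)
  (W : measurableType dw).
Variables (P : probability Omega R) (PW : probability W R) (pi : W -> TS)
  (L : W -> giry T1 R) (S : {mfun Omega >-> TS}) (Y : {mfun Omega >-> T1}).
Hypotheses (mpi : measurable_fun setT pi) (mL : measurable_fun setT L).

(** Here [PW] is the law of an upstream state, [pi] reads [S] off that state and [L] is the law of
    [Y] given it. Thus [(Y, S)] has a mixture law, known on rectangles and extended to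
    integrands. *)
Lemma integral_mixture :
  (forall A E, measurable A -> measurable E ->
    P (S @^-1` A `&` Y @^-1` E) = \int[PW]_(s in pi @^-1` A) L s E) ->
  forall A h, measurable A -> measurable_fun setT h -> (forall y, 0 <= h y) ->
  \int[P]_(w in S @^-1` A) h (Y w) =
  \int[PW]_(s in pi @^-1` A) \int[L s]_y h y.
Proof.
move=> PE A h mA mh h0.
pose M s := kernel_with L (s, pi s).
have mM : measurable_fun setT M.
  apply: (measurableT_comp (measurable_kernel_with mL)).
  exact: measurable_fun_pair.
(* Restricting the domain becomes an indicator factor, so that the integrand is a function of the
   pair [(Y, S)]. *)
have patch_indic U (f : U -> \bar R) (phi : U -> TS) B u :
    (f \_ (phi @^-1` B)) u = f u * (\1_B (phi u))%:E.
  rewrite patchE indicE (_ : (phi u \in B) = (u \in phi @^-1` B)).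
    by case: (_ \in _); rewrite ?mule1 ?mule0.
  by apply/idP/idP; rewrite !inE.
have lawE C : measurable C -> distribution P (pair_rv Y S) C = \int[PW]_s M s C.
  move=> mC; transitivity (giry_bind PW mM C); last first.
    by rewrite /giry_bind/= giry_int_map//; exact: measurable_giry_ev.
  apply: eq_measure_rectangles mC => [|E B mE mB].
    by rewrite [X in X < _]probability_setT ltry.
  rewrite /giry_bind/= giry_int_map//; last first.
    by apply: measurable_giry_ev; exact: measurableX.
  rewrite [LHS](_ : _ = P (S @^-1` B `&` Y @^-1` E)); last first.
    by congr (P _); apply/seteqP; split=> w /= [].
  rewrite PE// integral_mkcond; apply: eq_integral => s _.
  by rewrite patch_indic -[RHS]/(M s (E `*` B)) kernel_withE.
have mhA : measurable_fun setT (fun z : T1 * TS => h z.1 * (\1_A z.2)%:E).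
  apply: emeasurable_funM; first exact: measurableT_comp.
  by apply/measurable_EFinP; exact: measurableT_comp.
have hA0 (z : T1 * TS) : 0 <= h z.1 * (\1_A z.2)%:E.
  by rewrite mule_ge0// lee_fin.
rewrite integral_mkcond; under eq_integral do rewrite patch_indic.
transitivity (\int[distribution P (pair_rv Y S)]_z (h z.1 * (\1_A z.2)%:E)).
  by rewrite ge0_integral_distribution.
rewrite (giry_bind_integral mM lawE hA0 mhA).
rewrite [RHS]integral_mkcond; apply: eq_integral => s _; rewrite patch_indic.
rewrite [LHS](giry_int_prod1 (L s) (giry_ret (pi s)) mhA hA0)/=.
rewrite -ge0_integralZr//; apply: eq_integral => y _.
rewrite giry_int_ret//=.
apply: emeasurable_funM => //.
by apply/measurable_EFinP.
Qed.

(** [K] sees the upstream state only through [Y]. The whole space for [F] yields the mixture law of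
    [(Y, S)]; integrating [K] at [F] against it gives the hypothesis of data processing. *)
Lemma mutual_info_markov_chain (Z : {mfun Omega >-> T2}) (K : T1 -> giry T2 R) :
  measurable_fun setT K -> (forall y, K y setT = 1) ->
  (forall A E F, measurable A -> measurable E -> measurable F ->
    P (S @^-1` A `&` Y @^-1` E `&` Z @^-1` F) =
    \int[PW]_(s in pi @^-1` A) \int[L s]_(y in E) K y F) ->
  mutual_info P Z S <= mutual_info P Y S.
Proof.
move=> mK K1 PE; apply: (mutual_info_data_processing mK K1) => A F mA mF.
rewrite (integral_mixture _ mA (h := K ^~ F))//; last 2 first.
- move=> B E mB mE.
  rewrite [LHS](_ : _ =
      P (S @^-1` B `&` Y @^-1` E `&` Z @^-1` setT)); last first.
    by rewrite preimage_setT setIT.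
  rewrite PE//; apply: eq_integral => s _.
  by under eq_integral do rewrite K1; rewrite integral_cst// mul1e.
- exact: (measurableT_comp (measurable_giry_ev mF)).
by rewrite -PE// preimage_setT setIT.
Qed.

End markov_chain.

(** * The Markov chains contained in the structural causal model *)

Section markov_scm_chains.
Context (R : realType) (d ds0 ds dx dc dg dr dt : measure_display)
  (Omega : measurableType d) (ES0 : measurableType ds0) (ES : measurableType ds)
  (EX : measurableType dx) (EC : measurableType dc) (EG : measurableType dg)
  (ER : measurableType dr) (ET : measurableType dt).
Variables (P : probability Omega R)
  (Sstar : {mfun Omega >-> ES0}) (Stil : {mfun Omega >-> ES})
  (X : {mfun Omega >-> EX}) (C : {mfun Omega >-> EC}) (G : {mfun Omega >-> EG})
  (Rep : {mfun Omega >-> ER}) (Ttil T : {mfun Omega >-> ET}).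
Hypothesis markov : markov_scm P Sstar Stil X C G Rep Ttil T.

(** Whole spaces in the factorization remove the other variables; [L] is the law of [G] given both
    factors, with [X] and [C] integrated out. *)
Lemma markov_scm_chain :
  exists (PS : probability (ES0 * ES)%type R) (L : (ES0 * ES)%type -> giry EG R)
    (K : R.-pker EG ~> ER) (K' : R.-pker ER ~> ET),
  measurable_fun setT L /\
  forall A E F H,
    measurable A -> measurable E -> measurable F -> measurable H ->
    P (Stil @^-1` A `&` G @^-1` E `&` Rep @^-1` F `&` T @^-1` H) =
    \int[PS]_(s in snd @^-1` A) \int[L s]_(g in E) \int[K g]_(r in F) K' r H.
Proof.
have [PS [PC [kX [kG [kTtil [kR [kT PE]]]]]]] := markov.
(* The factorization integrates over [C] outside [X], so the pair is swapped before entering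
   [kG]. *)
pose kG' (z : EC * EX) := pker_giry kG (z.2, z.1).
have mkG' : measurable_fun setT kG'.
  apply: (measurableT_comp (measurable_pker_giry kG)).
  exact: measurable_fun_pair.
pose L s := giry_bind (giry_prod (PC : giry EC R, pker_giry kX s)) mkG'.
exists PS, L, kR, kT; split.
  apply: (measurableT_comp (measurable_giry_bind mkG')).
  apply: (measurableT_comp measurable_giry_prod).
  by apply: measurable_fun_pair => //; exact: measurable_pker_giry.
move=> A E F H mA mE mF mH.
rewrite [LHS](_ : _ = P (Sstar @^-1` setT `&` Stil @^-1` A `&` X @^-1` setT
    `&` C @^-1` setT `&` G @^-1` E `&` Rep @^-1` F `&` Ttil @^-1` setT
    `&` T @^-1` H)); last by rewrite !preimage_setT setTI !setIT.
rewrite PE// setTX; apply: eq_integral => s _.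
(* Extension by zero outside [E] gives an integral over the whole space, as the bind formula
   demands. *)
pose h := (fun g => \int[kR g]_(r in F) kT r H) \_ E.
have h0 g : 0 <= h g.
  by rewrite /h erestrict_ge0// => ? _; exact: integral_ge0.
have mh : measurable_fun setT h.
  apply/(measurable_restrictT _ mE).1/measurable_funTS.
  under eq_fun do rewrite integral_mkcond.
  apply: measurable_fun_integral_kernel.
  - by move=> U mU; exact: measurable_kernel.
  - by move=> r; rewrite erestrict_ge0.
  - apply/(measurable_restrictT _ mF).1/measurable_funTS.
    exact: measurable_kernel.
rewrite [RHS]integral_mkcond -/h [RHS](giry_int_bind _ mkG' mh h0).
rewrite (giry_int_prod1 (PC : giry EC R) (pker_giry kX s)); last 2 first.
- exact: (measurableT_comp (measurable_giry_int mh h0)).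
- by move=> z; exact: integral_ge0.
apply: eq_integral => c _; apply: eq_integral => x _.
rewrite [RHS](_ : _ = \int[kG (x, c)]_g h g)// /h -integral_mkcond.
by apply: eq_integral => g _; rewrite prob_kernel mul1e.
Qed.

(** The chain from [Stil] through [G] to [Rep], with [T] left unconstrained. *)
Lemma mutual_info_rep_le : mutual_info P Rep Stil <= mutual_info P G Stil.
Proof.
have [PS [L [K [K' [mL PE]]]]] := markov_scm_chain.
have K1 g : pker_giry K g setT = 1 by exact: prob_kernel.
apply: (mutual_info_markov_chain _ mL (measurable_pker_giry K) K1) => //.
  exact: measurable_snd.
move=> A E F mA mE mF.
rewrite [LHS](_ : _ = P (Stil @^-1` A `&` G @^-1` E `&` Rep @^-1` F
    `&` T @^-1` setT)); last by rewrite preimage_setT setIT.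
rewrite (PE _ _ _ _ mA mE mF measurableT).
apply: eq_integral => s _; apply: eq_integral => g _.
under eq_integral do rewrite prob_kernel.
by rewrite integral_cst// mul1e.
Qed.

(** The chain from [Stil] through [Rep] to [T]: the law of [Rep] given the factors is [L] followed
    by [K]. *)
Lemma mutual_info_pred_le : mutual_info P T Stil <= mutual_info P Rep Stil.
Proof.
have [PS [L [K [K' [mL PE]]]]] := markov_scm_chain.
have mK := measurable_pker_giry K.
have K'1 r : pker_giry K' r setT = 1 by exact: prob_kernel.
apply: (mutual_info_markov_chain (pi := snd) (PW := PS)
  (L := fun s => giry_bind (L s) mK) _ _ (measurable_pker_giry K') K'1).
- exact: measurable_snd.
- exact: (measurableT_comp (measurable_giry_bind mK)).
move=> A F H mA mF mH.
rewrite [LHS](_ : _ = P (Stil @^-1` A `&` G @^-1` setT `&` Rep @^-1` F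
    `&` T @^-1` H)); last by rewrite preimage_setT setIT.
rewrite (PE _ _ _ _ mA measurableT mF mH); apply: eq_integral => s _.
rewrite [RHS]integral_mkcond [RHS]giry_int_bind; last 2 first.
- apply/(measurable_restrictT _ mF).1/measurable_funTS.
  exact: (measurable_kernel K').
- by move=> r; rewrite erestrict_ge0.
by apply: eq_integral => g _; rewrite integral_mkcond.
Qed.

End markov_scm_chains.

(** * Equal joint laws and the conclusion *)

Section same_law.
Context (R : realType) d d1 ds (Omega : measurableType d)
  (T1 : measurableType d1) (TS : measurableType ds).

(** Data processing along the identity kernel, the Dirac mass at each point. *)
Lemma mutual_info_same_law (P Q : probability Omega R)
    (Y Z : {mfun Omega >-> T1}) (S S' : {mfun Omega >-> TS}) :
  (forall A B, measurable A -> measurable B ->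
    Q (S' @^-1` A `&` Z @^-1` B) = P (S @^-1` A `&` Y @^-1` B)) ->
  mutual_info Q Z S' <= mutual_info P Y S.
Proof.
move=> QP; apply: (mutual_info_data_processing measurable_giry_ret) => //.
  exact: diracT.
move=> A B mA mB; rewrite QP//.
have mSA : measurable (S @^-1` A).
  by rewrite -[X in measurable X]setTI; exact: measurable_funPT.
rewrite (_ : \int[P]_(w in _) _ =
    \int[P]_(w in S @^-1` A) (\1_(Y @^-1` B) w)%:E).
  rewrite integral_indic 1?setIC//.
  by rewrite -[X in measurable X]setTI; exact: measurable_funPT.
by apply: eq_integral.
Qed.

End same_law.

Theorem theorem4 (R : realType)
    (d ds0 ds dx dc dg dr dt : measure_display)
    (Omega : measurableType d)
    (ES0 : measurableType ds0) (ES : measurableType ds)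
    (EX : measurableType dx) (EC : measurableType dc)
    (EG : measurableType dg) (ER : measurableType dr)
    (ET : measurableType dt)
    (bES0 : standard_borel R ES0) (bES : standard_borel R ES)
    (bEX : standard_borel R EX) (bEC : standard_borel R EC)
    (bEG : standard_borel R EG) (bER : standard_borel R ER)
    (bET : standard_borel R ET)
    (Theta : Type) (P : Theta -> probability Omega R)
    (Sstar : {mfun Omega >-> ES0}) (Stil : {mfun Omega >-> ES})
    (X : {mfun Omega >-> EX}) (C : {mfun Omega >-> EC})
    (G : {mfun Omega >-> EG}) (Rep : {mfun Omega >-> ER})
    (Ttil T : {mfun Omega >-> ET})
    (markov : forall theta, markov_scm (P theta) Sstar Stil X C G Rep Ttil T)
    (fixed_law : forall (theta theta' : Theta)
       (D : set (ES0 * ES * EX * EC * EG * ET)), measurable D ->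
       P theta [set w | D (Sstar w, Stil w, X w, C w, G w, Ttil w)] =
       P theta' [set w | D (Sstar w, Stil w, X w, C w, G w, Ttil w)])
    (nu : {measure set ET -> \bar R})
    (p : ET -> R) (pc : ET -> ES -> R)
    (q : Theta -> ET -> R) (qc : Theta -> ET -> ES -> R)
    (hp : forall theta, is_density (P theta) nu Ttil p)
    (hpc : forall theta, is_cond_density (P theta) nu Ttil Stil pc)
    (hq : forall theta, is_density (P theta) nu T (q theta))
    (hqc : forall theta, is_cond_density (P theta) nu T Stil (qc theta))
    (effective : forall theta,
       mutual_info (P theta) Ttil Stil = mutual_info (P theta) G Stil)
    (theta0 : Theta)
    (matching : forall (t : ET) (s : ES), pc t s = qc theta0 t s) :
  forall theta : Theta,
    mutual_info (P theta) Rep Stil <= mutual_info (P theta0) Rep Stil.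
Proof.
move=> theta; apply: le_trans (mutual_info_rep_le (markov theta)) _.
rewrite -effective; apply: le_trans (mutual_info_pred_le (markov theta0)).
apply: mutual_info_same_law => A B mA mB.
(* The joint law of [Stil] and [Ttil] is first moved from [theta] to [theta0], so that both
   conditional densities are integrated against the same law of [Stil]. *)
transitivity (P theta0 (Stil @^-1` A `&` Ttil @^-1` B)).
  pose D : set (ES0 * ES * EX * EC * EG * ET) :=
    [set z | A z.1.1.1.1.2 /\ B z.2].
  apply: (fixed_law theta theta0 D).
  have -> : D = (fun z => z.1.1.1.1.2) @^-1` A `&` snd @^-1` B by [].
  apply: measurableI; rewrite -[X in measurable X]setTI.
    by do 5 apply: (measurableT_comp _ _) => //.
  exact: measurable_snd.
have [_ _ ->//] := hpc theta0; have [_ _ ->//] := hqc theta0.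
by apply: eq_integral => s _; apply: eq_integral => t _; rewrite matching.
Qed.
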